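(* Let $A$ be an $n\times n$ complex matrix having $0$ as an eigenvalue with $m(0)=\nu(0)$. Write $A=Q^{-1}JQ$ with $J$ in Jordan normal form, where the first diagonal block of $J$ is the (unique) Jordan block for the eigenvalue $0$, of size $m(0)$, with ones on the superdiagonal. Let $v_R$ be the first column of $Q^{-1}$ (a right $0$-eigenvector of $A$) and $v_L$ the $m(0)$-th row of $Q$ (a left $0$-eigenvector of $A$). Then $$\operatorname{adj}(A)=(-1)^{m(0)-1}\left(\prod_{\lambda\neq0}\lambda^{m(\lambda)}\right)v_Rv_L=\left(\prod_{\lambda\neq0}\lambda^{m(\lambda)}\right)(-A)^{\nu(0)-1}E_0 ,$$ where the products range over the distinct nonzero eigenvalues $\lambda$ of $A$.
   Context: $m(\lambda)$ is the algebraic multiplicity and $\nu(\lambda)$ the index (multiplicity as a root of the minimal polynomial) of an eigenvalue $\lambda$. The adjugate is the transpose of the cofactor matrix. Spectral projector: let $e_0(x)$ be a polynomial with $e_0(0)=1$, $e_0^{(j)}(0)=0$ for $1\le j\le\nu(0)-1$, and $e_0^{(j)}(\mu)=0$ for every eigenvalue $\mu\neq 0$ and $0\le j\le\nu(\mu)-1$; $E_0:=e_0(A)$. $v_Rv_L$ denotes the outer product (column times row). *)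

(* Defs.v *)
(* Mathematical Components, with C realised as R[i] over R : realType. *)
From HB Require Import structures.
From mathcomp Require Import all_boot all_order all_algebra.
From mathcomp Require Import reals complex.

Set Implicit Arguments.
Unset Strict Implicit.
Unset Printing Implicit Defensive.

Import GRing.Theory.
Local Open Scope ring_scope.

Section JordanForm.
Variable F : fieldType.

Definition jordan_block (n : nat) (a : F) : 'M[F]_n :=
  \matrix_(i, j) (a *+ (i == j) + (i.+1 == j :> nat)%:R).

(* The k diagonal blocks have sizes p i and eigenvalues lam i.  The cast is
   needed because \mxdiag_i lives in dimension \sum_i p i, not n. *)
Definition is_jordan_form (n k : nat) (p : 'I_k -> nat) (lam : 'I_k -> F)
    (J : 'M[F]_n) : Prop :=
  (forall i, (0 < p i)%N) /\
  exists eq_n : (\sum_i p i = n)%N,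
    J = castmx (eq_n, eq_n) (\mxdiag_i jordan_block (p i) (lam i)).

End JordanForm.

Section Spectrum.
Variables (F : closedFieldType) (n : nat).
Implicit Types (A : 'M[F]_n.+1) (a mu : F).

Definition alg_mult A a : nat := mup a (char_poly A).

Definition eigen_index A a : nat := mup a (mxminpoly A).

(* closed_field_poly_normal lists the roots with multiplicity. *)
Definition eigenvalues A : seq F :=
  undup (sval (closed_field_poly_normal (char_poly A))).

Lemma eigenvalues_uniq A : uniq (eigenvalues A).
Proof. exact: undup_uniq. Qed.

Lemma mem_eigenvalues A a : (a \in eigenvalues A) = eigenvalue A a.
Proof.
rewrite /eigenvalues mem_undup eigenvalue_root_char.
case: (closed_field_poly_normal _) => r /= def_r; rewrite def_r.
by rewrite (monicP (char_poly_monic A)) scale1r root_prod_XsubC.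
Qed.

Definition is_projector_poly A (e0 : {poly F}) : Prop :=
  [/\ e0.[0] = 1,
      forall j, (1 <= j <= (eigen_index A 0).-1)%N -> e0^`(j).[0] = 0
    & forall mu, eigenvalue A mu -> mu != 0 ->
        forall j, (j <= (eigen_index A mu).-1)%N -> e0^`(j).[mu] = 0].

End Spectrum.

(* Main.v *)
Require Import Defs.
From HB Require Import structures.
From mathcomp Require Import all_boot all_order all_algebra.
From mathcomp Require Import reals complex.

Set Implicit Arguments.
Unset Strict Implicit.
Unset Printing Implicit Defensive.

Import GRing.Theory Num.Theory.
Local Open Scope ring_scope.

(** Write the characteristic polynomial of [A] as [X^m g] with [g(0) <> 0].
    Comparing coefficients in [adj(X - A) (X - A) = X^m g(X)] gives
    [adj(A) = (-1)^n A^(m-1) g(A)] in dimension [n + 1].  The projector formula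
    holds because the minimal polynomial divides [X^(m-1) (g - g(0) e_0)], which
    is checked one root at a time.  For the Jordan form it remains to compute
    [X := J^(m-1) g(J)]: its first row is read off the nilpotent block, the
    other rows of that block vanish, and [J X = 0] kills the rows outside it
    since [J] is upper bidiagonal there with a nonzero diagonal. *)

(** * The adjugate as a polynomial in the matrix *)

(** View adj(X - A) as a polynomial [P] with matrix coefficients. Its constant coefficient is
    adj(-A), and the coefficients of [P] satisfy a Horner-like recursion whose unrolling is q(A). *)
Lemma adjN_horner_mx (R : comNzRingType) n (A : 'M[R]_n.+1) (q : {poly R}) c :
  char_poly A = q * 'X + c%:P -> \adj (- A) = horner_mx A q.
Proof.
move=> Dchar; have [phi [_ phiZ phiC phiE]] := mx_poly_ring_isom R n.
set P := phi (\adj (char_poly_mx A)).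
have PE : P * ('X - A%:P) = map_poly scalar_mx (char_poly A).
  by rewrite -phiZ -mul_adj_mx rmorphM rmorphB /= phiC phiZ map_polyX.
have P0 : P`_0 = \adj (- A).
  apply/matrixP=> i j; rewrite phiE -horner_coef0.
  have -> : - A = map_mx (horner_eval 0) (char_poly_mx A).
    apply/matrixP=> k l; rewrite !mxE /horner_eval !hornerE.
    by case: (k == l); rewrite ?mulr1n ?mulr0n ?hornerX ?hornerC sub0r.
  by rewrite -map_mx_adj [RHS]mxE.
have PS k : P`_k = (q`_k)%:M + P`_k.+1 *m A.
  have /(congr1 (fun r : {poly 'M_n.+1} => r`_k.+1)) := PE.
  rewrite mulrBr coefB coefMX coefMC coef_map Dchar coefD coefMX coefC /= addr0.
  by move/eqP; rewrite subr_eq => /eqP.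
have PN N : P`_0 = \sum_(k < N) ((q`_k)%:M *m A ^+ k) + P`_N *m A ^+ N.
  elim: N => [|N IHN]; first by rewrite big_ord0 add0r expr0 mulmx1.
  rewrite big_ord_recr /= exprS -[A * _]/(A *m _) mulmxA -addrA -mulmxDl -PS.
  exact: IHN.
rewrite -P0 (PN (maxn (size q) (size P))) nth_default ?leq_maxr // mul0mx addr0.
rewrite /horner_mx /= /horner_morph.
rewrite (@horner_coef_wide _ (maxn (size q) (size P))).
  by apply: eq_bigr => i _; rewrite coef_map.
by apply: leq_trans (size_poly _ _) (leq_maxl _ _).
Qed.

Lemma adj_horner_mx (R : comNzRingType) n (A : 'M[R]_n.+1) (q : {poly R}) c :
  char_poly A = q * 'X + c%:P -> \adj A = (-1) ^+ n *: horner_mx A q.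
Proof.
move/adjN_horner_mx => <-.
by rewrite -[- A]scaleN1r adjZ scalerA -expr2 sqrr_sign scale1r.
Qed.

(** * Invariance of the characteristic polynomial *)

Lemma char_poly_tr (R : comNzRingType) n (A : 'M[R]_n) :
  char_poly A^T = char_poly A.
Proof.
rewrite /char_poly -det_tr; congr (\det _).
by apply/matrixP=> i j; rewrite !mxE eq_sym.
Qed.

Lemma char_poly_conj (F : fieldType) n (Q J : 'M[F]_n) : Q \in unitmx ->
  char_poly (invmx Q *m J *m Q) = char_poly J.
Proof.
move=> Qu; have E : map_mx polyC (invmx Q) *m map_mx polyC Q = 1%:M.
  by rewrite -map_mxM mulVmx // map_mx1.
have -> : char_poly (invmx Q *m J *m Q) =
   \det (map_mx polyC (invmx Q) *m char_poly_mx J *m map_mx polyC Q).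
  congr (\det _); rewrite /char_poly_mx mulmxBr mulmxBl !map_mxM.
  by rewrite mul_mx_scalar -scalemxAl E scalemx1.
by rewrite !det_mulmx mulrAC -det_mulmx E det1 mul1r.
Qed.

(** * Divisibility tested root by root *)

Lemma dvdp_exp_derivn (F : numFieldType) (a : F) k (p : {poly F}) :
  (forall j, (j < k)%N -> root p^`(j) a) -> ('X - a%:P) ^+ k %| p.
Proof.
elim: k p => [|k IHk] p p_a; first by rewrite expr0 dvd1p.
have dvd_dp : ('X - a%:P) ^+ k %| p^`().
  by apply: IHk => j lt_jk; rewrite -derivSn; apply: p_a.
have [->|nz_p] := eqVneq p 0; first exact: dvdp0.
have [[|s] [q]] := multiplicity_XsubC p a; rewrite nz_p /= => qNa Dp.
  by case/negP: qNa; move: (p_a 0 isT); rewrite derivn0 Dp mulr1.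
have [lt_ks|lt_sk] := leqP k s.
  by rewrite Dp dvdp_mull // dvdp_exp2l.
(* If the multiplicity s+1 of [a] were at most [k], then (X - a)^(s+1) would divide p'. Cancelling
   (X - a)^s and evaluating at [a] leaves (s+1) q(a) = 0, contradicting q(a) <> 0. *)
case/negP: qNa.
have: ('X - a%:P) ^+ s.+1 %| p^`().
  by apply: dvdp_trans dvd_dp; apply: dvdp_exp2l.
rewrite Dp !derivCE /= !exprS mul1r mulrnAr -mulrnAl mulrA -mulrDl.
rewrite dvdp_mul2r ?expf_neq0 ?polyXsubC_eq0 // dvdp_XsubCl rootE.
by rewrite !(hornerE, hornerMn) subrr mulr0 add0r mulrn_eq0.
Qed.

Lemma prod_XsubC_undup (F : fieldType) (s : seq F) :
  \prod_(a <- s) ('X - a%:P) =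
  \prod_(a <- undup s) ('X - a%:P) ^+ (count_mem a s).
Proof.
by rewrite -big_undup_iterop_count.
Qed.

Lemma dvdp_prod_XsubC_exp (F : fieldType) (u : seq F) (f : F -> nat)
    (r : {poly F}) :
  uniq u -> {in u, forall a, ('X - a%:P) ^+ f a %| r} ->
  \prod_(a <- u) ('X - a%:P) ^+ f a %| r.
Proof.
elim: u => [|a u IHu] /=; first by rewrite big_nil dvd1p.
case/andP=> a_u /IHu{}IHu dvd_r; rewrite big_cons Gauss_dvdp.
  rewrite dvd_r ?mem_head //= IHu // => b u_b.
  by apply: dvd_r; rewrite inE u_b orbT.
rewrite coprimep_expl // coprimep_sym coprimep_XsubC /root horner_prod.
rewrite prodf_seq_neq0; apply/allP=> b u_b /=.
rewrite horner_exp !hornerE expf_neq0 // subr_eq0.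
by apply: contraNneq a_u => ->.
Qed.

(** Over a closed field [p] is, up to its leading coefficient, a product of pairwise coprime powers
    of linear factors. *)
Lemma dvdp_closed_mup (F : closedFieldType) (p r : {poly F}) :
  (forall a, root p a -> ('X - a%:P) ^+ mup a p %| r) -> p != 0 -> p %| r.
Proof.
move=> dvd_r nz_p; have [s Dp] := closed_field_poly_normal p.
rewrite Dp dvdpZl ?lead_coef_eq0 // prod_XsubC_undup.
apply: dvdp_prod_XsubC_exp => [|a]; first exact: undup_uniq.
rewrite mem_undup => s_a; rewrite -mu_prod_XsubC.
have := dvd_r a; rewrite Dp rootZ ?lead_coef_eq0 // root_prod_XsubC => /(_ s_a).
by rewrite -mul_polyC mupMr // rootC lead_coef_eq0.
Qed.

(** * The factorization X^m g of the characteristic polynomial *)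

Lemma eigenvalue_alg_mult_gt0 (F : closedFieldType) n (A : 'M[F]_n.+1) a :
  eigenvalue A a -> (0 < alg_mult A a)%N.
Proof.
rewrite eigenvalue_root_char -dvdp_XsubCl XsubC_dvd //.
exact/monic_neq0/char_poly_monic.
Qed.

Lemma char_poly_eigenvalues (F : closedFieldType) n (A : 'M[F]_n.+1) :
  char_poly A = \prod_(a <- eigenvalues A) ('X - a%:P) ^+ alg_mult A a.
Proof.
rewrite /alg_mult /eigenvalues; case: (closed_field_poly_normal _) => s /=.
rewrite (monicP (char_poly_monic A)) scale1r => ->.
by rewrite [LHS]prod_XsubC_undup; apply: eq_bigr => a _; rewrite mu_prod_XsubC.
Qed.

(** This is the factor g. Written as a product rather than a quotient, it shows g(0) as a signed
    product of the nonzero eigenvalues. *)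
Definition char_poly_coX (F : closedFieldType) n (A : 'M[F]_n.+1) : {poly F} :=
  \prod_(a <- eigenvalues A | a != 0) ('X - a%:P) ^+ alg_mult A a.

Lemma char_poly_coXE (F : closedFieldType) n (A : 'M[F]_n.+1) :
  eigenvalue A 0 -> char_poly A = 'X ^+ alg_mult A 0 * char_poly_coX A.
Proof.
rewrite -mem_eigenvalues => A0; rewrite {1}char_poly_eigenvalues.
by rewrite (bigD1_seq _ A0 (eigenvalues_uniq A)) /= subr0.
Qed.

Lemma adj_char_poly_coX (F : closedFieldType) n (A : 'M[F]_n.+1) :
  eigenvalue A 0 ->
  \adj A = (-1) ^+ n *:
    (A ^+ (alg_mult A 0).-1 *m horner_mx A (char_poly_coX A)).
Proof.
move=> A0; have m_gt0 := eigenvalue_alg_mult_gt0 A0.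
rewrite (@adj_horner_mx _ _ A ('X ^+ (alg_mult A 0).-1 * char_poly_coX A) 0).
  by rewrite rmorphM rmorphXn /= horner_mx_X.
by rewrite addr0 mulrAC -exprSr prednK // char_poly_coXE.
Qed.

(** With d = deg g, g(0) carries the sign (-1)^d. Degrees give n + 1 = m + d, so n + d = (m - 1) +
    2d and only (-1)^(m-1) survives. *)
Lemma char_poly_coX0 (F : closedFieldType) n (A : 'M[F]_n.+1) :
  eigenvalue A 0 ->
  (-1) ^+ n * (char_poly_coX A).[0] = (-1) ^+ (alg_mult A 0).-1
    * \prod_(a <- eigenvalues A | a != 0) a ^+ alg_mult A a.
Proof.
move=> A0; have m_gt0 := eigenvalue_alg_mult_gt0 A0.
pose d := (\sum_(a <- eigenvalues A | a != 0%R) alg_mult A a)%N.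
have sz_g : size (char_poly_coX A) = d.+1.
  rewrite /char_poly_coX /d; elim: (eigenvalues A) => [|a s IHs].
    by rewrite !big_nil size_poly1.
  rewrite !big_cons; case: ifP => // _.
  rewrite size_monicM ?monic_exp ?monicXsubC //.
    by rewrite IHs size_exp_XsubC addnS.
  by apply/monic_neq0/monic_prod => b _; rewrite monic_exp ?monicXsubC.
have nz_g : char_poly_coX A != 0 by rewrite -size_poly_eq0 sz_g.
have /(congr1 (fun p : {poly F} => size p)) := char_poly_coXE A0.
rewrite size_char_poly size_monicM ?monicXn // size_polyXn sz_g.
rewrite addnS addSn /= => -[def_n].
have -> : (char_poly_coX A).[0] = (-1) ^+ d *
    \prod_(a <- eigenvalues A | a != 0) a ^+ alg_mult A a.
  rewrite horner_prod /d -prodrXr -big_split /=; apply: eq_bigr => a _.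
  by rewrite horner_exp hornerXsubC sub0r -exprNn.
rewrite mulrA -exprD; congr (_ * _).
case: (alg_mult A 0) m_gt0 def_n => // m _ [->] /=.
by rewrite -addnA addnn exprD -muln2 exprM sqrr_sign mulr1.
Qed.

Lemma dvdp_char_poly_coX (F : closedFieldType) n (A : 'M[F]_n.+1) a k :
  eigenvalue A 0 -> a != 0 ->
  ('X - a%:P) ^+ k %| char_poly A -> ('X - a%:P) ^+ k %| char_poly_coX A.
Proof.
move=> A0 nz_a; rewrite char_poly_coXE // Gauss_dvdpr //.
rewrite coprimep_expl // coprimep_expr // coprimep_sym coprimep_XsubC.
by rewrite rootE hornerX.
Qed.

(** * The projector formula *)

Lemma adj_projector (C : numClosedFieldType) n (A : 'M[C]_n.+1)
    (e0 : {poly C}) :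
  eigenvalue A 0 -> alg_mult A 0 = eigen_index A 0 -> is_projector_poly A e0 ->
  \adj A =
    (\prod_(a <- eigenvalues A | a != 0) a ^+ alg_mult A a)
    *: ((- A) ^+ (eigen_index A 0).-1 *m horner_mx A e0).
Proof.
move=> A0 A_mult0 [e0_0 _ e0_mu]; rewrite -A_mult0.
have m_gt0 := eigenvalue_alg_mult_gt0 A0.
set m := alg_mult A 0 in A_mult0 m_gt0 *; set g := char_poly_coX A.
have nz_mu : mxminpoly A != 0 by rewrite monic_neq0 ?mxminpoly_monic.
have nz_ch : char_poly A != 0 by rewrite monic_neq0 ?char_poly_monic.
(* Evaluated at A, this divisibility says A^(m-1) g(A) = g(0) A^(m-1) e0(A). *)
have /mxminpoly_minP : mxminpoly A %| 'X ^+ m.-1 * (g - g.[0] *: e0).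
  apply: dvdp_closed_mup (nz_mu) => a a_root.
  have [->|nz_a] := eqVneq a 0.
    (* At 0 the exponent required is [m], the index: X^(m-1) supplies all but one factor, and the
       last comes from e0(0) = 1. *)
    rewrite -[mup _ _]A_mult0 subr0 -[X in 'X ^+ X](prednK m_gt0) exprSr.
    rewrite dvdp_mul // -['X]subr0 dvdp_XsubCl rootE !hornerE e0_0 mulr1.
    by rewrite subrr.
  (* At a nonzero root both terms are divisible: g because the minimal polynomial divides the
     characteristic one, [e0] by its vanishing derivatives. *)
  apply/dvdp_mull/dvdp_sub.
    apply: dvdp_char_poly_coX => //.
    by apply: dvdp_trans (mxminpoly_dvd_char A); rewrite -mup_geq.
  rewrite -mul_polyC; apply/dvdp_mull/dvdp_exp_derivn => j lt_j.
  apply/eqP/e0_mu => //; first by rewrite eigenvalue_root_char -root_mxminpoly.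
  by rewrite -ltnS prednK // (leq_ltn_trans _ lt_j).
rewrite rmorphM rmorphB rmorphXn /= horner_mx_X linearZ /= mulrBr => /eqP.
rewrite subr_eq0 => /eqP Eg; rewrite adj_char_poly_coX // -/m -/g !mulmxE Eg.
rewrite -[- A]scaleN1r exprZn -scalerAl scalerA [in RHS]mulrC.
rewrite -char_poly_coX0 //.
by rewrite -scalerAr scalerA.
Qed.

(** * Bidiagonal matrices with a leading nilpotent block *)

Lemma row_nilpotent_exp (F : pzRingType) n (J : 'M[F]_n.+1) m :
  (m <= n)%N ->
  (forall i : 'I_n.+1, (i < m)%N -> row i J = delta_mx 0 (inord i.+1)) ->
  forall k (i : 'I_n.+1), (i + k <= m)%N ->
    row i (J ^+ k) = delta_mx 0 (inord (i + k)).
Proof.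
move=> le_mn Jrow; elim=> [|k IHk] i le_ik.
  by rewrite expr0 addn0 inord_val rowE mulmx1.
rewrite addnS in le_ik; rewrite exprSr -mulmxE row_mul IHk ?(ltnW le_ik) //.
rewrite -rowE Jrow inordK ?addnS //.
  by rewrite ltnS ltnW // (leq_trans le_ik).
by rewrite ltnS ltnW // (leq_trans le_ik).
Qed.

(** Here [m] is the last index of the nilpotent block, whose size is therefore m + 1. *)
Lemma bidiag_annihilated (F : fieldType) n (J X : 'M[F]_n.+1) (g : {poly F}) m
    (d b : 'I_n.+1 -> F) :
  (m <= n)%N ->
  (forall i j, J i j = d i *+ (i == j) + b i *+ (i.+1 == j :> nat)) ->
  (forall i : 'I_n.+1, (d i == 0) = (i <= m)%N) ->
  (forall i : 'I_n.+1, (i <= m)%N -> b i = (i < m)%N%:R) ->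
  J *m X = 0 -> X = J ^+ m *m horner_mx J g ->
  X = g.[0] *: delta_mx ord0 (inord m).
Proof.
move=> le_mn JE d0 bE JX0 XE.
have Jrow (i : 'I_n.+1) : (i < m)%N -> row i J = delta_mx 0 (inord i.+1).
  move=> lt_im; apply/rowP=> j; rewrite !mxE JE.
  have /eqP-> : d i == 0 by rewrite d0 ltnW.
  rewrite mul0rn add0r.
  rewrite bE; last exact: ltnW.
  rewrite lt_im -[j == _]val_eqE /= inordK; first by rewrite eq_sym.
  exact: leq_trans lt_im _.
have Jrow_m : row (inord m) J = 0.
  apply/rowP=> j; rewrite !mxE JE bE ?inordK // ltnn mul0rn addr0.
  have /eqP-> : d (inord m) == 0 by rewrite d0 inordK.
  by rewrite mul0rn.
have grow_m : row (inord m) (horner_mx J g) = g.[0] *: delta_mx 0 (inord m).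
  elim/poly_ind: (g) => [|p c IHp]; first by rewrite rmorph0 horner0 scale0r row0.
  rewrite rmorphD rmorphM /= horner_mx_X horner_mx_C !hornerE.
  rewrite linearD /= -mulmxE row_mul IHp -scalemxAl -rowE Jrow_m scaler0 add0r.
  by rewrite rowE mul_mx_scalar.
(* Row i of J X = 0 reads d_i X_i + b_i X_(i+1) = 0 with d_i <> 0. *)
have Xrow_step (i : 'I_n.+1) : (m < i)%N ->
    (forall l : 'I_n.+1, l = i.+1 :> nat -> row l X = 0) -> row i X = 0.
  move=> lt_mi Xnext; apply/rowP=> j.
  have nz_d : d i != 0 by rewrite d0 -ltnNge.
  have /matrixP/(_ i j) := JX0; rewrite !mxE (bigD1 i) //= big1 => [|l neq_li].
    rewrite JE eqxx mulr1n (gtn_eqF (ltnSn i)) addr0 addr0 => /eqP.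
    by rewrite mulf_eq0 (negPf nz_d) => /eqP.
  rewrite JE eq_sym (negPf neq_li) add0r; case: eqP => [il|_]; last by rewrite mul0r.
  by have /rowP/(_ j) := Xnext l (esym il); rewrite !mxE => ->; rewrite mulr0.
(* Downward induction from the last row, run on the distance n - i. *)
have Xrow_big k : forall i : 'I_n.+1, (n - i <= k)%N -> (m < i)%N -> row i X = 0.
  elim: k => [|k IHk] i le_nik lt_mi; apply: Xrow_step => // l il.
    by have := ltn_ord l; rewrite il ltnS ltnNge -subn_eq0 -leqn0 le_nik.
  apply: IHk; rewrite il ?(leqW lt_mi) // subnS -ltnS (leq_trans _ le_nik) //.
  by rewrite ltn_predL subn_gt0 -ltnS -il ltn_ord.
apply/row_matrixP=> i; rewrite linearZ /=.
have [lt_mi|le_im] := ltnP m i.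
  rewrite (Xrow_big _ _ (leqnn _) lt_mi); apply/rowP=> j; rewrite !mxE.
  by rewrite -val_eqE /= (gtn_eqF (leq_ltn_trans _ lt_mi)) ?mulr0.
have Jexp := row_nilpotent_exp le_mn Jrow.
rewrite XE row_mul; have [i0|i_neq0] := eqVneq i ord0.
  rewrite i0 Jexp // add0n -rowE grow_m; congr (_ *: _).
  by apply/rowP=> j; rewrite !mxE.
have i_gt0 : (0 < i)%N by rewrite lt0n -[0%N]/(val (@ord0 n)) val_eqE.
(* Row i of J^(m-i) is the unit row e_m, which the next factor J kills. *)
have -> : J ^+ m = J ^+ (m - i) *m (J *m J ^+ i.-1).
  by rewrite !mulmxE -exprS prednK // -exprD subnK.
rewrite row_mul Jexp subnKC // mulmxA -rowE Jrow_m !mul0mx.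
by apply/rowP=> j; rewrite !mxE (negPf i_neq0) mulr0.
Qed.

(** * Entries of a Jordan form *)

Lemma mxdiag_Rank (V : nmodType) k (p : 'I_k -> nat)
    (B : forall i, 'M[V]_(p i)) i (a b : 'I_(p i)) :
  mxdiag B (tagnat.Rank i a) (tagnat.Rank i b) = B i a b.
Proof. by have /matrixP/(_ a b) := submxblock_diag B i; rewrite mxE. Qed.

Lemma mxdiag_Rank0 (V : nmodType) k (p : 'I_k -> nat)
    (B : forall i, 'M[V]_(p i)) i j (a : 'I_(p i)) (b : 'I_(p j)) :
  i != j -> mxdiag B (tagnat.Rank i a) (tagnat.Rank j b) = 0.
Proof.
move=> neq_ij; have : submxblock (mxdiag B) i j = 0.
  by rewrite mxblockK (negPf neq_ij).
by move/matrixP/(_ a b); rewrite !mxE.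
Qed.

(** [tagnat.Rank i a] is the global position of place [a] in block [i]. The superdiagonal
    coefficient drops to 0 at the last place of a block, since the next position belongs to another
    block. *)
Lemma mxdiag_jordanE (F : fieldType) k (p : 'I_k -> nat) (lam : 'I_k -> F)
    i (a : 'I_(p i)) (t : 'I_(\sum_i p i)) :
  (\mxdiag_i jordan_block (p i) (lam i)) (tagnat.Rank i a) t =
    lam i *+ (tagnat.Rank i a == t)
    + (a.+1 < p i)%N%:R *+ ((tagnat.Rank i a).+1 == t :> nat).
Proof.
rewrite -(tagnat.sig2K t) -[_ == tagnat.Rank _ _]val_eqE tagnat.eq_Rank.
move: (tagnat.sig1 t) (tagnat.sig2 t) => {t} j b.
have [eq_ij|neq_ij] := eqVneq i j.
  case: _ / eq_ij b => b; rewrite mxdiag_Rank mxE !tagnat.RankEsum.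
  rewrite -addnS eqn_add2l val_eqE; case: (a.+1 =P b) => [->|_]; last by rewrite mulr0n.
  by rewrite ltn_ord.
rewrite mxdiag_Rank0 //= add0r; case: (ltnP a.+1 (p i)) => [lt_a|_]; last first.
  by rewrite mul0rn.
have -> : (tagnat.Rank i a).+1 = tagnat.Rank i (Ordinal lt_a).
  by rewrite !tagnat.RankEsum addnS.
by rewrite tagnat.eq_Rank (negPf neq_ij).
Qed.

Lemma jordan_form_bidiag (F : fieldType) n k (p : 'I_k.+1 -> nat)
    (lam : 'I_k.+1 -> F) (J : 'M[F]_n) :
  is_jordan_form p lam J ->
  exists d b : 'I_n -> F,
    [/\ forall i j, J i j = d i *+ (i == j) + b i *+ (i.+1 == j :> nat),
        forall i : 'I_n, (i < p ord0)%N -> d i = lam ord0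
      & forall i : 'I_n, (i < p ord0)%N -> b i = (i.+1 < p ord0)%N%:R].
Proof.
case=> _ [eq_n ->]; case: n / eq_n J => J.
exists (fun s => lam (tagnat.sig1 s)).
exists (fun s => ((tagnat.sig2 s).+1 < p (tagnat.sig1 s))%N%:R).
(* No block precedes block [ord0], so local and global positions agree there. *)
have Rank0 (s : 'I_(\sum_i p i)) : (s < p ord0)%N ->
    exists2 a : 'I_(p ord0), a = s :> nat & s = tagnat.Rank ord0 a.
  move=> lt_s; exists (Ordinal lt_s) => //.
  by apply: ord_inj; rewrite [RHS]tagnat.RankEsum [X in (X + _)%N]big_pred0.
split=> [s t|s /Rank0[a _ ->]|s /Rank0[a as_ Ds]].
- rewrite castmx_id; have := mxdiag_jordanE lam (tagnat.sig2 s) t.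
  by rewrite tagnat.sig2K.
- by rewrite tagnat.Rank1K.
by rewrite -as_ Ds tagnat.Rank2K [nat_of_ord (cast_ord _ _)]/= tagnat.Rank1K.
Qed.

Lemma char_poly_bidiag (F : fieldType) n (J : 'M[F]_n) (d b : 'I_n -> F) :
  (forall i j, J i j = d i *+ (i == j) + b i *+ (i.+1 == j :> nat)) ->
  char_poly J = \prod_i ('X - (d i)%:P).
Proof.
(* [char_poly_trig] expects a lower triangular matrix, hence the transpose. *)
move=> JE; rewrite -char_poly_tr char_poly_trig.
  by apply: eq_bigr => i _; rewrite mxE JE eqxx gtn_eqF // addr0.
apply/is_trig_mxP=> i j lt_ij; rewrite mxE JE -val_eqE /= !gtn_eqF ?addr0 //.
exact: ltnW.
Qed.

Lemma alg_mult_bidiag (F : closedFieldType) n (J : 'M[F]_n.+1)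
    (d b : 'I_n.+1 -> F) a :
  (forall i j, J i j = d i *+ (i == j) + b i *+ (i.+1 == j :> nat)) ->
  alg_mult J a = #|[pred i | d i == a]|.
Proof.
move=> JE; rewrite /alg_mult (char_poly_bidiag JE).
rewrite -(big_map d xpredT (fun x => 'X - x%:P)) mu_prod_XsubC count_map.
by rewrite -sum1_count -sum1_card; apply: eq_bigl => i; rewrite inE.
Qed.

(** * The adjugate of a Jordan form and of its conjugates *)

Lemma adj_jordan_form (F : closedFieldType) n k (p : 'I_k.+1 -> nat)
    (lam : 'I_k.+1 -> F) (J : 'M[F]_n.+1) :
  eigenvalue J 0 -> is_jordan_form p lam J ->
  lam ord0 = 0 -> p ord0 = alg_mult J 0 ->
  \adj J = ((-1) ^+ n * (char_poly_coX J).[0])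
             *: delta_mx ord0 (inord (alg_mult J 0).-1).
Proof.
move=> J0 J_jf lam0 p0; have [d [b [JE dE bE]]] := jordan_form_bidiag J_jf.
have m_gt0 := eigenvalue_alg_mult_gt0 J0; rewrite p0 lam0 in dE bE.
have mE := alg_mult_bidiag 0 JE.
have le_mn : (alg_mult J 0 <= n.+1)%N.
  by rewrite mE -[leqRHS]card_ord max_card.
(* The first block already contributes m zeros to the diagonal, and the algebraic multiplicity
   allows no more, so [d] is nonzero elsewhere. *)
have d0 (i : 'I_n.+1) : (d i == 0) = (i < alg_mult J 0)%N.
  have sub : [pred i : 'I_n.+1 | (i < alg_mult J 0)%N] \subset [pred i | d i == 0].
    by apply/subsetP=> l; rewrite !inE => /dE->.
  have /subset_cardP/(_ sub)/(_ i) : #|[pred i : 'I_n.+1 | (i < alg_mult J 0)%N]|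
      = #|[pred i | d i == 0]|.
    rewrite -mE -sum1_card (big_ord_narrow le_mn) sum1_card card_ord //.
  by rewrite !inE.
set m := alg_mult J 0 in m_gt0 le_mn dE bE d0 *.
rewrite -scalerA.
rewrite -(@bidiag_annihilated _ _ J (J ^+ m.-1 *m horner_mx J (char_poly_coX J))
            _ m.-1 d b) //.
- exact: adj_char_poly_coX.
- by rewrite -ltnS prednK.
- by move=> i; rewrite -ltnS prednK.
- by move=> i; rewrite -ltnS prednK // => /bE->; rewrite -[in RHS]ltnS prednK.
(* J adj(J) = det(J) I = 0, and adj(J) is X up to sign, whence J X = 0. *)
have detJ0 : \det J = 0.
  move: J0; rewrite eigenvalue_root_char rootE horner_coef0 char_poly_det.
  by rewrite mulf_eq0 signr_eq0 => /eqP.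
have := mul_mx_adj J; rewrite adj_char_poly_coX // -/m -scalemxAr detJ0 raddf0.
by move/eqP; rewrite scaler_eq0 signr_eq0 => /eqP.
Qed.

(** g and m depend only on the characteristic polynomial, which [A] and [J] share. As adj is then
    the same polynomial in each matrix, it commutes with the conjugation by [Q]. *)
Lemma adj_conj_jordan_form (F : closedFieldType) n k (p : 'I_k.+1 -> nat)
    (lam : 'I_k.+1 -> F) (A J Q : 'M[F]_n.+1) :
  eigenvalue A 0 -> is_jordan_form p lam J ->
  lam ord0 = 0 -> p ord0 = alg_mult A 0 ->
  Q \in unitmx -> A = invmx Q *m J *m Q ->
  \adj A =
    ((-1) ^+ (alg_mult A 0).-1
     * \prod_(a <- eigenvalues A | a != 0) a ^+ alg_mult A a)
    *: (col ord0 (invmx Q) *m row (inord (alg_mult A 0).-1) Q).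
Proof.
move=> A0 J_jf lam0 p0 Qu AE.
have char_AJ : char_poly A = char_poly J by rewrite AE char_poly_conj.
have multE a : alg_mult A a = alg_mult J a by rewrite /alg_mult char_AJ.
have coXE : char_poly_coX A = char_poly_coX J.
  rewrite /char_poly_coX /eigenvalues char_AJ.
  by apply: eq_bigr => a _; rewrite multE.
have J0 : eigenvalue J 0.
  by rewrite eigenvalue_root_char -char_AJ -eigenvalue_root_char.
rewrite -(char_poly_coX0 A0) (adj_char_poly_coX A0) coXE multE.
have -> : A ^+ (alg_mult J 0).-1 *m horner_mx A (char_poly_coX J) =
    horner_mx A ('X ^+ (alg_mult J 0).-1 * char_poly_coX J).
  by rewrite rmorphM rmorphXn /= horner_mx_X.
rewrite AE horner_mx_uconjC // rmorphM rmorphXn /= horner_mx_X.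
rewrite scalemxAl scalemxAr -(adj_char_poly_coX J0).
rewrite (adj_jordan_form J0 J_jf) -?multE // -scalemxAr -scalemxAl.
(* The matrix unit left by [J] splits as a unit column times a unit row, which select the column of
   [invmx Q] and the row of [Q]. *)
by rewrite rowE colE !mulmxA -(mulmxA _ (delta_mx _ _) (delta_mx _ _)) mul_delta_mx.
Qed.

Theorem mainTheorem6 (R : realType) (n : nat) (A : 'M[R[i]]_n.+1)
    (A_eigen0 : eigenvalue A 0)
    (A_mult0 : alg_mult A 0 = eigen_index A 0) :
  (forall (k : nat) (p : 'I_k.+1 -> nat) (lam : 'I_k.+1 -> R[i])
          (J Q : 'M[R[i]]_n.+1),
      is_jordan_form p lam J ->
      lam ord0 = 0 -> p ord0 = alg_mult A 0 ->
      Q \in unitmx -> A = invmx Q *m J *m Q ->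
      \adj A =
        ((-1) ^+ (alg_mult A 0).-1
         * \prod_(a <- eigenvalues A | a != 0) a ^+ alg_mult A a)
        *: (col ord0 (invmx Q) *m row (inord (alg_mult A 0).-1) Q))
  /\
  (forall e0 : {poly R[i]},
      is_projector_poly A e0 ->
      \adj A =
        (\prod_(a <- eigenvalues A | a != 0) a ^+ alg_mult A a)
        *: ((- A) ^+ (eigen_index A 0).-1 *m horner_mx A e0)).
Proof.
split=> [k p lam J Q J_jf lam0 p0 Qu AE|e0].
  exact: adj_conj_jordan_form J_jf lam0 p0 Qu AE.
exact: adj_projector.
Qed.
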